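(* Let $n\ge3$, and let $m_1,\dots,m_n$ be distinct positive integers, at least one of which is odd. For any exponents $p_1,\dots,p_n,r$ satisfying $$\frac1n<r<\frac12,\qquad 1<p_i<\infty,\qquad \frac1r=\sum_{1\le i\le n}\frac1{p_i},$$ there is no finite constant $C$ such that the inequality $$\bigg\|\mathrm{p.v.}\int_{\mathbb R}\prod_{1\le i\le n}f_i\Big(x-\frac{t^{m_i}}{m_i}\Big)\frac{dt}{t}\bigg\|_{L^r_x(\mathbb R)}\le C\prod_{1\le i\le n}\|f_i\|_{L^{p_i}(\mathbb R)}$$ holds for all functions $f_i\in L^{p_i}(\mathbb R)$, $1\le i\le n$.
   Context: For $0<r<1$, $\|f\|_{L^r}=(\int|f|^r)^{1/r}$. The principal value is the limit as $\epsilon\to0^+$ of the integral over $|t|>\epsilon$. *)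

(* Defs.v *)
From mathcomp Require Import all_boot all_order all_algebra.
From mathcomp Require Import all_classical all_reals all_analysis.
Set Implicit Arguments.
Unset Strict Implicit.
Unset Printing Implicit Defensive.
Import Order.TTheory GRing.Theory Num.Theory.
Import numFieldNormedType.Exports.
Local Open Scope classical_set_scope.
Local Open Scope ring_scope.

Definition truncated_integral (R : realType) (g : R -> R) (e : R) : R :=
  Rintegral lebesgue_measure [set t | e < `|t|] g.

(* Absolute integrability of every truncation is required: otherwise
   [Rintegral] returns a default value and convergence would be meaningless. *)
Definition pv_exists (R : realType) (g : R -> R) : Prop :=
  (forall e : R, 0 < e ->
     lebesgue_measure.-integrable [set t | e < `|t|] (EFin \o g)) /\
  cvg (truncated_integral g e @[e --> 0^'+]).

(* Only meaningful when [pv_exists g]. *)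
Definition pv (R : realType) (g : R -> R) : R :=
  lim (truncated_integral g e @[e --> 0^'+]).

Definition hilbert_integrand (R : realType) (n : nat) (m : 'I_n -> nat)
    (f : 'I_n -> R -> R) (x t : R) : R :=
  (\prod_(i < n) f i (x - t ^+ m i / (m i)%:R)) / t.

(* Main.v *)
Require Import Defs.
From mathcomp Require Import all_boot all_order all_algebra.
From mathcomp Require Import all_classical all_reals all_analysis.
From mathcomp Require Import measurable_realfun ring lra.
Import Order.TTheory GRing.Theory Num.Theory.
Import numFieldNormedType.Exports.
Local Open Scope classical_set_scope.
Local Open Scope ring_scope.

(** The curves [t |-> t ^+ m i / m i] all have slope 1 at [t = 1], where their
    values are the distinct numbers [1 / m i].  The test functions are the
    indicators of the intervals of half-length [delta] centred at [- 1 / m i].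
    At [(x, t)] their product is 1 exactly when
    [x + 1 / m i - t ^+ m i / m i] has absolute value at most [delta] for
    every [i].

    With [s = t - 1], this quantity is [x - s] up to an error of order [s ^ 2].
    So for all [x] in a window of half-length [a], with [delta] comparable to
    [a ^ 2], the product equals 1 on a set of [t] near [1 + x] of measure
    comparable to [delta] ([close_near_tangent]).  The window has length of
    order [sqrt delta], much longer than [delta]: this is where the parallel
    tangents enter.

    There is no cancellation for such [x]: an odd exponent excludes negative
    [t] ([close_ge0]).  Nor is there a singularity, for any [x]: since the
    numbers [1 / m i] are distinct, the product vanishes for [t] near 0
    ([close_away_from0]), and the principal value is an ordinary integral
    ([pv_vanishing_near0]).  Hence the principal value is at least a multiple
    of [delta] on the window ([integral_bump_ge]), and its [L^r] norm is at
    least a multiple of [delta * delta ^ (1 / (2 * r))], while the product of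
    the norms of the test functions is [(2 * delta) ^ (1 / r)].  Since
    [r < 1 / 2], the exponent [1 + 1 / (2 * r)] is smaller than [1 / r], and the
    ratio of the two is unbounded as [delta] tends to 0. *)

(** * Norms of indicators *)

(** The integral of a nonnegative function is a supremum over the simple
    functions below it, so it is monotone on arbitrary functions. *)
Lemma ge0_le_integralT (d : measure_display) (T : measurableType d)
    (R : realType) (mu : {measure set T -> \bar R}) (f g : T -> \bar R) :
  (forall x, 0 <= f x)%E -> (forall x, f x <= g x)%E ->
  (\int[mu]_x f x <= \int[mu]_x g x)%E.
Proof.
move=> f0 fg; rewrite !ge0_integralTE//; last first.
  by move=> x; exact: le_trans (fg x).
apply: le_ereal_sup => _ [h /= hf <-]; exists h => //= x.
exact: le_trans (fg x).
Qed.

Lemma Lnorm_indic (d : measure_display) (T : measurableType d) (R : realType)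
    (mu : {measure set T -> \bar R}) (p : R) (A : set T) :
  p != 0 -> measurable A ->
  ('N[mu]_(p%:E)[EFin \o (\1_A : T -> R)] = mu A `^ p^-1)%E.
Proof.
move=> p0 mA; rewrite unlock; congr (_ `^ _)%E.
rewrite -[in RHS](setIT A) -integral_indic//; apply: eq_integral => x _ /=.
rewrite indicE; case: (x \in A) => /=.
  by rewrite normr1 powR1.
by rewrite normr0 powR0.
Qed.

Lemma indic_Lfun (d : measure_display) (T : measurableType d) (R : realType)
    (mu : {measure set T -> \bar R}) (p : R) (A : set T) :
  p != 0 -> measurable A -> (mu A < +oo)%E ->
  (\1_A : T -> R) \in Lfun mu p%:E.
Proof.
move=> p0 mA muA; apply/andP; split; rewrite inE/=.
  exact: measurable_indic.
by rewrite /finite_norm Lnorm_indic// poweR_lty.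
Qed.

(** Chebyshev's inequality: the indicator of [A] scaled by [c `^ r] lies below
    [`|F| `^ r].  The function [F] is arbitrary, since the principal value is
    to be bounded below directly, as a function of [x]. *)
Lemma ge_Lnorm_cst {d : measure_display} {T : measurableType d} {R : realType}
    (mu : {measure set T -> \bar R}) {r c : R} {A : set T} {F : T -> R} :
  0 < r -> 0 <= c -> measurable A -> (forall x, A x -> c <= F x) ->
  (c%:E * mu A `^ r^-1 <= 'N[mu]_(r%:E)[EFin \o F])%E.
Proof.
move=> r0 c0 mA cF; rewrite unlock.
have -> : (c%:E * mu A `^ r^-1 = ((c `^ r)%:E * mu A) `^ r^-1)%E.
  rewrite poweRM ?lee_fin ?powR_ge0// poweR_EFin -powRrM mulfV ?gt_eqF//.
  by rewrite powRr1.
apply: gt0_ler_poweR.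
- by rewrite invr_ge0 ltW.
- by rewrite in_itv/= leey andbT mule_ge0// lee_fin powR_ge0.
- by rewrite in_itv/= leey andbT integral_ge0// => x _; exact: poweR_ge0.
rewrite -[in leLHS](setIT A) -integral_indic// -ge0_integralZl//=; first last.
- by rewrite lee_fin powR_ge0.
- apply/measurable_EFinP; exact: measurable_indic.
apply: ge0_le_integralT => x.
  by rewrite lee_fin mulr_ge0// powR_ge0.
rewrite -[leRHS]/((`|F x| `^ r)%:E) -EFinM lee_fin indicE.
case: (boolP (x \in A)) => xA /=.
  rewrite mulr1 ge0_ler_powR ?nnegrE ?(ltW r0)//.
  by rewrite (le_trans (cF x _) (ler_norm _))//; rewrite inE in xA.
by rewrite mulr0 powR_ge0.
Qed.

(** * Auxiliary estimates on the real line *)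

Lemma powR_sum (R : realType) (I : finType) (a : R) (s : I -> R) :
  0 < a -> \prod_(i : I) a `^ s i = a `^ (\sum_(i : I) s i).
Proof.
move=> a0; elim/big_rec2 : _ => [|i y1 y2 _ ->]; first by rewrite powRr0.
by rewrite powRD// (gt_eqF a0) implybT.
Qed.

(** Real powers are measurable but represent the inverse only at nonnegative
    arguments; hence the identity [t^-1 = t * (t ^+ 2)^-1]. *)
Lemma measurable_inv (R : realType) :
  measurable_fun setT (fun t : R => t^-1).
Proof.
rewrite [X in measurable_fun _ X](_ : _ =
    (fun t : R => t * (t ^+ 2) `^ (-1))); last first.
  apply/funext => t; rewrite powR_inv1 ?sqr_ge0//.
  have [->|t0] := eqVneq t 0; first by rewrite invr0 mul0r.
  by field.
apply: measurable_funM => //.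
apply: (measurableT_comp (measurable_powR _)).
exact: measurable_funX.
Qed.

(** The truncated integrals do not depend on the truncation once it is below
    [eta], so the limit is that of an eventually constant function. *)
Lemma pv_vanishing_near0 {R : realType} {g : R -> R} {eta : R} :
  0 < eta -> (forall t, `|t| <= eta -> g t = 0) ->
  lebesgue_measure.-integrable setT (EFin \o g) ->
  pv_exists g /\ pv g = Rintegral lebesgue_measure setT g.
Proof.
move=> eta0 g0 ig.
have nearE : \forall e \near 0^'+,
    truncated_integral g e = Rintegral lebesgue_measure setT g.
  near=> e.
  rewrite /truncated_integral Rintegral_mkcond; congr Rintegral.
  apply/funext => t; rewrite patchE; case: ifPn => //.
  rewrite notin_setE/= => /negP; rewrite -leNgt => te; rewrite g0//.
  by rewrite (le_trans te)//; near: e; exact: nbhs_right_le.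
split; last exact: norm_lim_near_cst.
split; last exact: is_cvg_near_cst nearE.
move=> e e0; apply: integrableS ig => //.
rewrite -[X in measurable X]setTI.
have mn : measurable_fun [set: R] (fun t : R => `|t|).
  exact: normr_measurable.
rewrite [X in measurable (_ `&` X)](_ : _ =
    (fun t : R => `|t|) @^-1` `]e, +oo[).
  by apply: mn.
by apply/seteqP; split => t /=; rewrite in_itv/= andbT.
Unshelve. all: by end_near.
Qed.

(** A quantitative form of [a `^ s --> 0] as [a --> 0^'+]. *)
Lemma small_powR {R : realType} {s A : R} (B : R) {a0 : R} :
  0 < s -> 0 < A -> 0 < a0 ->
  exists2 a, 0 < a <= a0 & B * a `^ s < A.
Proof.
move=> s0 A0 a00.
pose u := A / (`|B| + 1); have B1 : 0 < `|B| + 1 by rewrite ltr_wpDl.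
have u0 : 0 < u by rewrite divr_gt0.
exists (Num.min a0 (u `^ s^-1)).
  by rewrite lt_min a00 powR_gt0//= ge_min lexx.
have h : (Num.min a0 (u `^ s^-1)) `^ s <= u.
  rewrite -[leRHS]powRr1 ?(ltW u0)// -(mulVf (lt0r_neq0 s0)) powRrM.
  rewrite ge0_ler_powR ?nnegrE ?invr_ge0 ?(ltW s0) ?powR_ge0//.
    by rewrite le_min powR_ge0 ltW.
  by rewrite ge_min lexx orbT.
apply: (@le_lt_trans _ _ (`|B| * u)).
  rewrite (le_trans (ler_wpM2r _ (ler_norm B))) ?powR_ge0//.
  by rewrite ler_wpM2l.
by rewrite /u mulrCA gtr_pMr// ltr_pdivrMr// mul1r ltrDl.
Qed.

(** By the binomial formula the left-hand side is [s ^+ 2] times a polynomial in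
    [s] with nonnegative coefficients, whose value at [s = 1] is the constant on
    the right; the bound is attained there. *)
Lemma second_order_expansion {R : realType} (k : nat) {s : R} :
  `|s| <= 1 ->
  `|(1 + s) ^+ k - 1 - k%:R * s| <= (2 ^+ k - 1 - k%:R) * s ^+ 2.
Proof.
move=> s1; elim: k => [|k IH].
  by rewrite !expr0 subrr !sub0r mul0r oppr0 normr0 mul0r.
have -> : (1 + s) ^+ k.+1 - 1 - k.+1%:R * s =
    (1 + s) * ((1 + s) ^+ k - 1 - k%:R * s) + k%:R * s ^+ 2.
  by rewrite exprS -natr1; ring.
have -> : (2 ^+ k.+1 - 1 - k.+1%:R) * s ^+ 2 =
    2 * ((2 ^+ k - 1 - k%:R) * s ^+ 2) + k%:R * s ^+ 2.
  by rewrite exprS -natr1; ring.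
rewrite (le_trans (ler_normD _ _))// normrM.
rewrite (ger0_norm (mulr_ge0 (ler0n R k) (sqr_ge0 s))) lerD2r.
apply: ler_pM => //.
by rewrite (le_trans (ler_normD _ _))// normr1; lra.
Qed.

Lemma lebesgue_measure_centered {R : realType} (u : R) {v : R} :
  0 < v -> lebesgue_measure (`[u - v, u + v]%classic : set R) = (2 * v)%:E.
Proof.
move=> v0; rewrite lebesgue_measure_itv/= lte_fin ifT; last by lra.
by rewrite -EFinB; congr EFin; ring.
Qed.

Lemma integrable_scaled_indic_itv (R : realType) (c a b : R) :
  lebesgue_measure.-integrable setT
    (EFin \o (fun t : R => c * \1_(`[a, b]) t)).
Proof.
have -> : EFin \o (fun t : R => c * \1_(`[a, b]) t) =
    (fun t => c%:E * (EFin \o \1_(`[a, b])) t)%E.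
  by apply/funext => t.
apply: integrableZl => //.
exact: integrable_indic_itv.
Qed.

(** * The test functions and their product *)

Definition bump {R : realType} {n : nat} (m : 'I_n -> nat) (delta : R)
    (i : 'I_n) : R -> R :=
  \1_(`[- (m i)%:R^-1 - delta, - (m i)%:R^-1 + delta]).

Definition all_close {R : realType} {n : nat} (m : 'I_n -> nat)
    (delta x t : R) : bool :=
  [forall i, `|x + (m i)%:R^-1 - t ^+ m i / (m i)%:R| <= delta].

Lemma bump_integrandE {R : realType} {n : nat} (m : 'I_n -> nat)
    (delta x t : R) :
  hilbert_integrand m (bump m delta) x t = (all_close m delta x t)%:R / t.
Proof.
rewrite /hilbert_integrand; congr (_ / _).
have bE i : bump m delta i (x - t ^+ m i / (m i)%:R) =
    (`|x + (m i)%:R^-1 - t ^+ m i / (m i)%:R| <= delta)%R%:R.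
  rewrite /bump indicE; congr (nat_of_bool _)%:R.
  rewrite mem_setE in_itv/= ler_norml.
  by congr (_ && _); apply/idP/idP; lra.
under eq_bigr do rewrite bE.
case: (boolP (all_close m delta x t)) => [/forallP c|/forallPn[i ci]].
  by rewrite big1// => i _; rewrite c.
by rewrite (bigD1 i)//= (negbTE ci) mul0r.
Qed.

Lemma invn_itv (R : realType) {k : nat} :
  (0 < k)%N -> 0 < (k%:R^-1 : R) <= 1.
Proof.
by move=> k0; rewrite invr_gt0 ltr0n k0/= invf_le1 ?ltr0n// ler1n.
Qed.

Lemma monomial_le {R : realType} {k : nat} {t : R} :
  (0 < k)%N -> `|t| <= 1 -> `|t ^+ k / k%:R| <= `|t|.
Proof.
move=> k0 t1; have /andP[i0 i1] := invn_itv R k0.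
rewrite normrM (ger0_norm (ltW i0)) normrX.
rewrite (le_trans (ler_piMr _ i1)) ?exprn_ge0//.
by case: k k0 {i0 i1} => // k _; rewrite exprS ler_piMr// exprn_ile1.
Qed.

(** For [t] near 0 all the conditions say that [x] is near [- 1 / m i], which
    cannot hold for two indices with different values of [m]. *)
Lemma close_away_from0 {R : realType} {n : nat}
    {m : 'I_n -> nat} {i j : 'I_n} {delta x t : R} :
  (0 < m i)%N -> (0 < m j)%N ->
  let D := `|(m i)%:R^-1 - (m j)%:R^-1| in
  0 < D -> 8 * delta <= D -> all_close m delta x t -> D / 8 < `|t|.
Proof.
move=> mi mj D D0 dD /forallP c; rewrite ltNge; apply/negP => tD.
have /andP[i0 i1] := invn_itv R mi; have /andP[j0 j1] := invn_itv R mj.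
have D1 : D <= 1 by rewrite /D ler_norml; lra.
have t1 : `|t| <= 1 by lra.
have := monomial_le mi t1; have := monomial_le mj t1.
have := c i; have := c j; move: D0 D1 dD tD.
rewrite /D; set u := t ^+ _ / _; set v := t ^+ _ / _.
set ii := (m i)%:R^-1; set jj := (m j)%:R^-1.
rewrite !(ler_norml _ delta) !(ler_norml _ `|t|).
by have [_|_] := lerP ii jj; lra.
Qed.

(** A single condition already confines [t] to a bounded set depending on
    [x]. *)
Lemma close_bounded {R : realType} {n : nat}
    {m : 'I_n -> nat} {i : 'I_n} {delta x t : R} :
  (0 < m i)%N -> all_close m delta x t ->
  `|t| <= 1 + (m i)%:R * (`|x| + 1 + delta).
Proof.
move=> mi /forallP/(_ i) c.
have /andP[i0 i1] := invn_itv R mi.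
have mR : 0 < (m i)%:R :> R by rewrite ltr0n.
have h : `|t| ^+ m i <= (m i)%:R * (`|x| + 1 + delta).
  rewrite -ler_pdivrMl// mulrC -normrX -(ger0_norm (ltW i0)) -normrM.
  have -> : t ^+ m i / (m i)%:R =
    x + (m i)%:R^-1 - (x + (m i)%:R^-1 - t ^+ m i / (m i)%:R) by ring.
  rewrite (le_trans (ler_normB _ _))// lerD//.
  by rewrite (le_trans (ler_normD _ _))// lerD2l ger0_norm// ltW.
have [t1|t1] := lerP `|t| 1.
  by rewrite (le_trans t1)// lerDl (le_trans _ h)// exprn_ge0.
apply: (@le_trans _ _ (`|t| ^+ m i)); last by rewrite (le_trans h)// lerDr.
by case: (m i) mi => // k _; rewrite exprS ler_peMr// exprn_ege1// ltW.
Qed.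

(** If [t < 0], the monomial of odd degree is negative, and the [i]-th condition
    would force [x + 1 / m i <= delta]. *)
Lemma close_ge0 {R : realType} {n : nat}
    {m : 'I_n -> nat} {i : 'I_n} {delta a x t : R} :
  odd (m i) -> a + delta < (m i)%:R^-1 -> `|x| <= a ->
  all_close m delta x t -> 0 <= t.
Proof.
move=> mi ad xa /forallP/(_ i) c; rewrite leNgt; apply/negP => t0.
have : t ^+ m i / (m i)%:R <= 0.
  by rewrite pmulr_lle0 ?invr_gt0 ?ltr0n ?odd_gt0// exprn_odd_le0// ltW.
by move: c xa; rewrite !ler_norml; lra.
Qed.

(** With [s = t - 1] the quantity to bound is the sum of [x - s], which is at
    most [delta / 2], and of the second-order error, at most
    [K * s ^+ 2 <= K * (2 * a) ^+ 2], which is again [delta / 2] for the choice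
    [delta = 8 * K * a ^+ 2]. *)
Lemma close_near_tangent {R : realType} {n : nat}
    {m : 'I_n -> nat} {K a x t : R} :
  (forall i, (0 < m i)%N) -> (forall i, 2 ^+ m i <= K) ->
  0 < a -> 1 <= K -> 4 * K * a <= 1 -> `|x| <= a ->
  `|t - 1 - x| <= 4 * K * a ^+ 2 -> all_close m (8 * K * a ^+ 2) x t.
Proof.
move=> m0 mK a0 K1 Ka xa tx; apply/forallP => i.
have /andP[i0 i1] := invn_itv R (m0 i).
pose s := t - 1.
have a2 : 4 * K * a ^+ 2 <= a by rewrite expr2 mulrA ger_pMl.
have sa : `|s| <= 2 * a.
  move: xa tx; rewrite /s !ler_norml; lra.
have a21 : 2 * a <= 1 by nra.
have := second_order_expansion (m i) (le_trans sa a21).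
set w := (1 + s) ^+ _ - _ - _ => hw.
have -> : x + (m i)%:R^-1 - t ^+ m i / (m i)%:R =
    - (t - 1 - x) - w * (m i)%:R^-1.
  have -> : t = 1 + s by rewrite /s; ring.
  rewrite /w /s; field.
  by rewrite pnatr_eq0 -lt0n.
rewrite (le_trans (ler_normB _ _))// normrN.
have -> : 8 * K * a ^+ 2 = 4 * K * a ^+ 2 + K * (2 * a) ^+ 2 by ring.
apply: lerD => //.
rewrite normrM (ger0_norm (ltW i0)).
rewrite (le_trans (ler_piMr _ i1))// (le_trans hw)//.
apply: ler_pM.
- by rewrite subr_ge0 lerBrDr natr1 -natrX ler_nat ltn_expl.
- exact: sqr_ge0.
- by have := mK i; have : 0 <= (m i)%:R :> R by []; lra.
- by rewrite -real_normK ?num_real// ler_pXn2r ?nnegrE ?mulr_ge0// ltW.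
Qed.

(** The integrand is bounded by [eta^-1] and has bounded support. *)
Lemma integrable_bump_integrand {R : realType} {n : nat}
    {m : 'I_n -> nat} {i : 'I_n} {delta eta x : R} :
  (0 < m i)%N -> 0 < eta ->
  (forall t, all_close m delta x t -> eta < `|t|) ->
  lebesgue_measure.-integrable setT
    (EFin \o hilbert_integrand m (bump m delta) x).
Proof.
move=> mi eta0 away.
pose M := 1 + (m i)%:R * (`|x| + 1 + delta).
have iM : lebesgue_measure.-integrable setT
    (EFin \o (fun t : R => eta^-1 * \1_(`[- M, M]) t)).
  exact: integrable_scaled_indic_itv.
apply: le_integrable iM => //.
  apply/measurable_EFinP; apply: measurable_funM; last exact: measurable_inv.
  apply: measurable_prod => k _.
  apply: (measurableT_comp (f := bump m delta k)).
    exact: measurable_indic.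
  by apply: measurable_funB => //; exact: measurable_funM.
move=> t _ /=; rewrite lee_fin bump_integrandE indicE.
case: (boolP (all_close m delta x t)) => c; last first.
  by rewrite mul0r normr0.
have tM : t \in `[- M, M]%classic.
  by rewrite mem_setE in_itv/= -ler_norml close_bounded.
rewrite tM mulr1 mul1r !normfV (gtr0_norm eta0).
have et := away _ c.
by rewrite lef_pV2 ?posrE// ?(lt_trans eta0 et)// ltW.
Qed.

(** On an interval of length [8 * K * a ^+ 2] around [1 + x] the integrand is
    [1 / t], which is at least [1 / 2]; elsewhere it is nonnegative. *)
Lemma integral_bump_ge {R : realType} {n : nat}
    {m : 'I_n -> nat} {i : 'I_n} {K a x : R} :
  (forall i, (0 < m i)%N) -> (forall i, 2 ^+ m i <= K) ->
  0 < a -> 1 <= K -> 4 * K * a <= 1 -> `|x| <= a ->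
  odd (m i) -> a + 8 * K * a ^+ 2 < (m i)%:R^-1 ->
  lebesgue_measure.-integrable setT
    (EFin \o hilbert_integrand m (bump m (8 * K * a ^+ 2)) x) ->
  4 * K * a ^+ 2 <= Rintegral lebesgue_measure setT
    (hilbert_integrand m (bump m (8 * K * a ^+ 2)) x).
Proof.
move=> m0 mK a0 K1 Ka xa oi ai ig.
set h := 4 * K * a ^+ 2.
have h0 : 0 < h by rewrite !mulr_gt0 ?exprn_gt0//; lra.
have a2 : h <= a by rewrite /h expr2 mulrA ger_pMl.
pose J : set R := `[1 + x - h, 1 + x + h]%classic.
have mJ : lebesgue_measure J = (2 * h)%:E.
  exact: lebesgue_measure_centered.
have -> : h = Rintegral lebesgue_measure setT (fun t => 2^-1 * \1_J t).
  rewrite RintegralZl//; last exact: integrable_indic_itv.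
  rewrite /Rintegral integral_indic ?setIT//; last exact: measurable_itv.
  rewrite [X in fine X](_ : _ = (2 * h)%:E); last exact: mJ.
  by rewrite /=; field.
apply: le_Rintegral => //.
  exact: integrable_scaled_indic_itv.
move=> t _; rewrite -[leRHS]/(hilbert_integrand m (bump m _) x t).
rewrite bump_integrandE indicE.
case: (boolP (t \in J)) => tJ; last first.
  rewrite mulr0.
  case: (boolP (all_close _ _ _ _)) => c; last by rewrite mul0r.
  by rewrite mul1r invr_ge0 (close_ge0 oi ai xa c).
have {}tJ : `|t - 1 - x| <= h.
  by move: tJ; rewrite mem_setE in_itv/= ler_norml; lra.
rewrite (close_near_tangent m0 mK a0 K1 Ka xa tJ) mulr1 mul1r.
have a41 : 4 * a <= 1 by nra.
have t2 : 0 < t /\ t <= 2 by move: xa tJ; rewrite !ler_norml; lra.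
by rewrite lef_pV2 ?posrE//; case: t2.
Qed.

(** * Unboundedness *)

Theorem propositionA2 (R : realType) (n : nat) (hn : (3 <= n)%N)
  (m : 'I_n -> nat) (m_pos : forall i : 'I_n, (0 < m i)%N)
  (m_inj : injective m) (m_odd : exists i : 'I_n, odd (m i))
  (p : 'I_n -> R) (r : R)
  (hr1 : n%:R^-1 < r) (hr2 : r < 2^-1)
  (hp : forall i : 'I_n, 1 < p i)
  (hrp : r^-1 = \sum_(i < n) (p i)^-1) :
  ~ exists C : R, forall f : 'I_n -> R -> R,
      (forall i : 'I_n, f i \in Lfun lebesgue_measure (p i)%:E) ->
      {ae lebesgue_measure, forall x : R,
         pv_exists (hilbert_integrand m f x)} ->
      ('N[lebesgue_measure]_(r%:E)
           [EFin \o (fun x : R => pv (hilbert_integrand m f x))] <=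
       C%:E * \prod_(i < n)
           'N[lebesgue_measure]_((p i)%:E)[EFin \o f i])%E.
Proof.
move=> [C bound].
have r0 : 0 < r by rewrite (le_lt_trans _ hr1)// invr_ge0.
pose q := r^-1.
have q2 : 0 < q - 2.
  by rewrite subr_gt0 -[2]invrK ltf_pV2 ?posrE// invr_gt0.
have [io oo] := m_odd.
pose j0 : 'I_n := Ordinal (ltn_trans (isT : (0 < 2)%N) hn).
pose j1 : 'I_n := Ordinal (ltn_trans (isT : (1 < 2)%N) hn).
pose D : R := `|(m j0)%:R^-1 - (m j1)%:R^-1|.
have D0 : 0 < D.
  by rewrite normr_gt0 subr_eq0 (inj_eq invr_inj) eqr_nat (inj_eq m_inj).
pose K : R := \sum_(i < n) 2 ^+ m i.
have mK i : 2 ^+ m i <= K.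
  by rewrite /K (bigD1 i)//= lerDl sumr_ge0// => *; rewrite exprn_ge0.
have K1 : 1 <= K by rewrite (le_trans _ (mK io))// exprn_ege1// ler1n.
have K0 : 0 < K by exact: lt_le_trans K1.
have io0 : 0 < (m io)%:R^-1 :> R by have /andP[] := invn_itv R (m_pos io).
(* The three bounds on [a] serve, in order, the hypothesis [4 * K * a <= 1] of
   the tangency estimate, the exclusion of negative [t] (where
   [a + delta <= 3 * a]), and the vanishing near 0 (where
   [8 * delta <= 16 * a]). *)
pose a0 : R := Num.min (4 * K)^-1 (Num.min ((m io)%:R^-1 / 4) (D / 16)).
have a00 : 0 < a0.
  by rewrite !lt_min invr_gt0 mulr_gt0//= !divr_gt0.
have [a /andP[apos]] := small_powR (C * (16 * K) `^ q) q2
  (mulr_gt0 (mulr_gt0 (ltr0n R 4) K0) (powR_gt0 q (ltr0n R 2))) a00.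
rewrite !le_min => /and3P[aK aio aD].
(* The window half-length [a] is chosen so that the inequality to be derived
   from the assumed bound fails. *)
rewrite ltNge => /negP; apply.
have Ka : 4 * K * a <= 1.
  by rewrite -ler_pdivlMl ?mulr1// mulr_gt0.
have a2 : 8 * K * a ^+ 2 <= 2 * a by nra.
pose delta := 8 * K * a ^+ 2.
have d0 : 0 < delta by rewrite !mulr_gt0 ?exprn_gt0.
have away x t : all_close m delta x t -> D / 8 < `|t|.
  by apply: close_away_from0 => //; rewrite -/D /delta; lra.
have int x := integrable_bump_integrand (m_pos io) (divr_gt0 D0 (ltr0n R 8))
  (away x).
have vanish x t : `|t| <= D / 8 -> hilbert_integrand m (bump m delta) x t = 0.
  move=> tD; rewrite bump_integrandE.
  case: (boolP (all_close _ _ _ _)) => [/away|]; first by rewrite ltNge tD.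
  by rewrite mul0r.
have pvE x := pv_vanishing_near0 (divr_gt0 D0 (ltr0n R 8)) (vanish x) (int x).
have p0 i : p i != 0 by rewrite gt_eqF// (lt_trans ltr01).
have inL i : bump m delta i \in Lfun lebesgue_measure (p i)%:E.
  apply: indic_Lfun => //.
  by rewrite [ltLHS](lebesgue_measure_centered _ d0) ltry.
have pv_ae : {ae lebesgue_measure, forall x : R,
    pv_exists (hilbert_integrand m (bump m delta) x)}.
  by apply: aeW => x; exact: (pvE x).1.
have := bound _ inL pv_ae.
rewrite (eq_bigr (fun i => ((2 * delta) `^ (p i)^-1)%:E)); last first.
  move=> i _; rewrite Lnorm_indic//.
  by rewrite [X in (X `^ _)%E](lebesgue_measure_centered _ d0).
rewrite prodEFin powR_sum ?mulr_gt0// -hrp -/q => upper.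
have pv_ge x : `[0 - a, 0 + a]%classic x ->
    4 * K * a ^+ 2 <= pv (hilbert_integrand m (bump m delta) x).
  rewrite sub0r add0r /= in_itv/= -ler_norml => xa.
  rewrite (pvE x).2.
  by apply: (integral_bump_ge m_pos mK apos K1 Ka xa oo) (int x); lra.
have h0 : 0 <= 4 * K * a ^+ 2 by rewrite ltW// !mulr_gt0 ?exprn_gt0.
have := le_trans (ge_Lnorm_cst lebesgue_measure r0 h0
  (measurable_itv _) pv_ge) upper.
rewrite [X in (X `^ _)%E](lebesgue_measure_centered _ apos) poweR_EFin.
rewrite -!EFinM lee_fin -/q => main.
have qE : a `^ q = a `^ (q - 2) * a ^+ 2.
  by rewrite -powR_mulrn ?(ltW apos)// -powRD ?subrK// (gt_eqF apos) implybT.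
have deltaE : 2 * delta = (16 * K) * (a * a) by rewrite /delta; ring.
have K16 : 0 <= 16 * K by rewrite mulr_ge0// ltW.
have age0 := ltW apos.
move: main; rewrite deltaE (powRM _ K16 (mulr_ge0 age0 age0)).
rewrite (powRM _ age0 age0) (powRM _ (ler0n R 2) age0) qE.
set w := a `^ (q - 2) => main.
have w0 : 0 < w * a ^+ 2 * a ^+ 2 by rewrite !mulr_gt0 ?exprn_gt0 ?powR_gt0.
(* The two norms compare as [a ^ (2 + q)] to [a ^ (2 * q)]; both carry the
   factor [w * a ^ 4]. *)
rewrite -(ler_pM2r w0).
have -> : 4 * K * 2 `^ q * (w * a ^+ 2 * a ^+ 2) =
    4 * K * a ^+ 2 * (2 `^ q * (w * a ^+ 2)) by ring.
by apply: (le_trans main); rewrite le_eqVlt; apply/orP; left; apply/eqP; ring.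
Qed.
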